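(* Let $\Sigma$ be the signature of commutative rings with unit extended by a unary inverse operation symbol ${}^{-1}$. For every $\Sigma$-equation $e$ (an identity $t=s$ between two $\Sigma$-terms with variables, universally quantified): $e$ holds in every zero totalized field if and only if $e$ holds in every meadow.
   Context: $\Sigma$ has constants $0,1$, binary operations $+,\cdot$, and unary operations $-$ and ${}^{-1}$; all operations are total. A meadow is a $\Sigma$-algebra that is a commutative ring with unit (possibly trivial) and satisfies $(x^{-1})^{-1}=x$ and $x\cdot(x\cdot x^{-1})=x$ for all $x$. A zero totalized field is a $\Sigma$-algebra that is a commutative ring with $0\neq1$, in which $x\cdot x^{-1}=1$ for all $x\neq 0$, and in which $0^{-1}=0$. *)

(* Defs.v *)
From Stdlib Require Import Ring_theory.

Record sigma_algebra : Type := SigmaAlgebra {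
  carrier :> Type;
  zero : carrier;
  one : carrier;
  add : carrier -> carrier -> carrier;
  mul : carrier -> carrier -> carrier;
  opp : carrier -> carrier;
  inv : carrier -> carrier
}.

Arguments zero {_}.
Arguments one {_}.
Arguments add {_} _ _.
Arguments mul {_} _ _.
Arguments opp {_} _.
Arguments inv {_} _.

Inductive sigma_term : Type :=
  | TVar (n : nat)
  | TZero
  | TOne
  | TAdd (t s : sigma_term)
  | TMul (t s : sigma_term)
  | TOpp (t : sigma_term)
  | TInv (t : sigma_term).

Fixpoint eval (A : sigma_algebra) (v : nat -> A) (t : sigma_term) : A :=
  match t with
  | TVar n => v n
  | TZero => zero
  | TOne => one
  | TAdd t1 t2 => add (eval A v t1) (eval A v t2)
  | TMul t1 t2 => mul (eval A v t1) (eval A v t2)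
  | TOpp t1 => opp (eval A v t1)
  | TInv t1 => inv (eval A v t1)
  end.

Record sigma_equation : Type := SigmaEquation {
  lhs : sigma_term;
  rhs : sigma_term
}.

Definition holds (A : sigma_algebra) (e : sigma_equation) : Prop :=
  forall v : nat -> A, eval A v (lhs e) = eval A v (rhs e).

(* [ring_theory] includes a subtraction, which is not in the signature:
   it is instantiated by x + (- y).  It does not require 0 <> 1. *)
Definition is_comm_ring (A : sigma_algebra) : Prop :=
  ring_theory (R := A) zero one add mul (fun x y => add x (opp y)) opp eq.

Record is_meadow (A : sigma_algebra) : Prop := IsMeadow {
  meadow_ring : is_comm_ring A;
  meadow_inv_inv : forall x : A, inv (inv x) = x;
  meadow_mul_inv : forall x : A, mul x (mul x (inv x)) = x
}.

Record is_zero_totalized_field (A : sigma_algebra) : Prop :=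
  IsZeroTotalizedField {
    ztf_ring : is_comm_ring A;
    ztf_zero_neq_one : (zero : A) <> one;
    ztf_mul_inv : forall x : A, x <> zero -> mul x (inv x) = one;
    ztf_inv_zero : inv (zero : A) = zero
  }.

(* Main.v *)
From Stdlib Require Import Ring Classical ClassicalEpsilon.
From Stdlib Require Import FunctionalExtensionality PropExtensionality.
From mathcomp Require classical_sets.
Require Import Defs.

(** Every zero totalized field is a meadow, so one direction is immediate.
    Conversely, let d = t - s be nonzero in a meadow M.  By Zorn's lemma there
    is an ideal P maximal among those avoiding d.  Since 1 - a a^-1 annihilates
    a, and d lies in the ideal generated by d^2, maximality forces a in P or
    1 - a a^-1 in P, for every a.  Hence inversion is compatible with
    congruence modulo P, and M/P is a zero totalized field, in which t = s
    fails. *)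

(** * Zero totalized fields are meadows *)

Section FieldMeadow.

Variable F : sigma_algebra.
Hypothesis F_field : is_zero_totalized_field F.

Let F_ring : ring_theory (R := F) zero one add mul
  (fun x y => add x (opp y)) opp eq := ztf_ring F F_field.

Add Ring field_ring : F_ring.

Lemma zero_totalized_field_is_meadow : is_meadow F.
Proof.
pose proof F_field as [_ Fneq Fmul Finv0].
split; [exact F_ring| |]; intros x; destruct (classic (x = zero)) as [->|xn0].
- now rewrite !Finv0.
- assert (xV := Fmul x xn0).
  assert (invn0 : inv x <> zero).
  { intros E; rewrite E in xV; apply Fneq; rewrite <- xV; ring. }
  assert (xVV := Fmul _ invn0).
  (* The product of x, its inverse and its double inverse collapses to the double inverse or to x,
     depending on which adjacent pair is cancelled first. *)
  transitivity (mul (mul x (inv x)) (inv (inv x))); [rewrite xV; ring|].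
  transitivity (mul x (mul (inv x) (inv (inv x)))); [ring|rewrite xVV; ring].
- ring.
- rewrite (Fmul x xn0); ring.
Qed.

End FieldMeadow.

(** * Ideals of a meadow maximal among those avoiding an element *)

Section MeadowQuotient.

Variable M : sigma_algebra.
Hypothesis M_meadow : is_meadow M.

Let M_ring : ring_theory (R := M) zero one add mul
  (fun x y => add x (opp y)) opp eq := meadow_ring M M_meadow.

Add Ring meadow_ring : M_ring.

Notation sub x y := (add x (opp y)).

Lemma sub_eq_zero (x y : M) : sub x y = zero -> x = y.
Proof.
intros E; transitivity (add (sub x y) y); [ring|rewrite E; ring].
Qed.

(* The empty set is admitted, so that unions of empty chains are covered. *)
Definition is_preideal (A : M -> Prop) : Prop :=
  (forall x y, A x -> A y -> A (add x y)) /\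
  (forall r x, A x -> A (mul r x)).

Definition is_maximal_avoiding (d : M) (P : M -> Prop) : Prop :=
  (is_preideal P /\ ~ P d) /\
  forall B : M -> Prop, (forall x, P x -> B x) -> is_preideal B -> ~ B d ->
    forall x, B x -> P x.

(** Zorn's lemma applies because any two elements of the union of a chain lie in a common member, so
    the union is again a preideal avoiding [d]. *)
Lemma exists_maximal_avoiding (d : M) : exists P, is_maximal_avoiding d P.
Proof.
destruct (@classical_sets.Zorn_bigcup M (fun A => is_preideal A /\ ~ A d))
  as [P [Ppre Pmax]].
- intros C CP Ctot; split; [split|].
  + intros x y [A CA Ax] [B CB By].
    destruct (Ctot A B CA CB) as [AB|BA].
    * exists B; [exact CB|]; apply (proj1 (CP B CB)); [now apply AB|exact By].
    * exists A; [exact CA|]; apply (proj1 (CP A CA)); [exact Ax|now apply BA].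
  + intros r x [A CA Ax]; exists A; [exact CA|].
    now apply (proj1 (CP A CA)).
  + intros [A CA Ad]; now apply (proj2 (CP A CA)).
- exists P; split; [exact Ppre|].
  intros B PB Bpre Bd x Bx; apply NNPP; intros nPx.
  apply (Pmax B); [|now split].
  split; [exact PB|intros BP; exact (nPx (BP x Bx))].
Qed.

Variables (d : M) (P : M -> Prop).
Hypothesis d_neq0 : d <> zero.
Hypothesis P_max : is_maximal_avoiding d P.

Let P_add : forall x y, P x -> P y -> P (add x y).
Proof. apply P_max. Qed.

Let P_mul : forall r x, P x -> P (mul r x).
Proof. apply P_max. Qed.

Let P_notin : ~ P d.
Proof. apply P_max. Qed.

(** If [P] were empty, it would be contained in the preideal {0}, which avoids [d]; maximality then
    puts 0 into [P]. *)
Lemma maximal_zero : P zero.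
Proof.
destruct P_max as [_ H].
destruct (classic (exists x, P x)) as [[x Px]|nP].
- replace (@zero M) with (mul zero x) by ring; now apply P_mul.
- apply (H (fun x => x = zero)); [| |exact d_neq0|reflexivity].
  + intros x Px; exfalso; eauto.
  + split; [intros x y -> ->|intros r x ->]; ring.
Qed.

(** The elements p + r a form a preideal containing both [P] and a; if it avoided [d], maximality
    would force a into [P]. *)
Lemma maximal_sum (a : M) : ~ P a -> exists p r, P p /\ d = add p (mul r a).
Proof.
intros nPa; apply NNPP; intros nd; apply nPa.
destruct P_max as [_ H].
apply (H (fun x => exists p r, P p /\ x = add p (mul r a))).
- intros x Px; exists x, zero; split; [exact Px|ring].
- split.
  + intros x y (p & r & Pp & ->) (q & s & Pq & ->).
    exists (add p q), (add r s); split; [now apply P_add|ring].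
  + intros s x (p & r & Pp & ->).
    exists (mul s p), (mul s r); split; [now apply P_mul|ring].
- exact nd.
- exists zero, one; split; [exact maximal_zero|ring].
Qed.

Lemma maximal_mul_inv (a : M) : ~ P a -> P (sub one (mul a (inv a))).
Proof.
intros nPa; apply NNPP; intros nPe.
destruct (maximal_sum _ nPa) as (p & r & Pp & Ed).
destruct (maximal_sum _ nPe) as (q & s & Pq & Ed').
assert (Edd : mul d d = add (mul (mul r a) q) (mul d p)).
{ transitivity (add (mul (mul r a) d) (mul d p)); [rewrite Ed at 1; ring|].
  rewrite Ed' at 1.
  (* The extra summand is r s times a (1 - a a^-1), which vanishes by the meadow law. *)
  transitivity (add (add (mul (mul r a) q) (mul d p))
    (mul (mul r s) (sub a (mul a (mul a (inv a)))))); [ring|].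
  rewrite (meadow_mul_inv M M_meadow a); ring. }
apply P_notin; rewrite <- (meadow_mul_inv M M_meadow d).
(* Here [d] is a multiple of its square, which lies in [P] by [Edd]. *)
replace (mul d (mul d (inv d))) with (mul (inv d) (mul d d)) by ring.
rewrite Edd; apply P_mul, P_add; now apply P_mul.
Qed.

(** * Congruence modulo the maximal ideal *)

Definition congr (x y : M) : Prop := P (sub x y).

Lemma congr_refl (x : M) : congr x x.
Proof.
unfold congr; replace (sub x x) with (@zero M) by ring; exact maximal_zero.
Qed.

Lemma congr_sym (x y : M) : congr x y -> congr y x.
Proof.
intros H; unfold congr.
replace (sub y x) with (mul (opp one) (sub x y)) by ring; now apply P_mul.
Qed.

Lemma congr_trans (x y z : M) : congr x y -> congr y z -> congr x z.
Proof.
intros H K; unfold congr.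
replace (sub x z) with (add (sub x y) (sub y z)) by ring; now apply P_add.
Qed.

Lemma congr_add (x x' y y' : M) :
  congr x x' -> congr y y' -> congr (add x y) (add x' y').
Proof.
intros H K; unfold congr.
replace (sub (add x y) (add x' y')) with (add (sub x x') (sub y y')) by ring.
now apply P_add.
Qed.

Lemma congr_mul (x x' y y' : M) :
  congr x x' -> congr y y' -> congr (mul x y) (mul x' y').
Proof.
intros H K; unfold congr.
replace (sub (mul x y) (mul x' y'))
  with (add (mul y (sub x x')) (mul x' (sub y y'))) by ring.
now apply P_add; apply P_mul.
Qed.

Lemma congr_opp (x x' : M) : congr x x' -> congr (opp x) (opp x').
Proof.
intros H; unfold congr.
replace (sub (opp x) (opp x')) with (mul (opp one) (sub x x')) by ring.
now apply P_mul.
Qed.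

Lemma congr_zero (x : M) : congr x zero <-> P x.
Proof.
unfold congr; replace (sub x zero) with x by ring; reflexivity.
Qed.

(** The meadow law at x^-1, combined with (x^-1)^-1 = x, exhibits x^-1 as a multiple of x. *)
Lemma maximal_inv (x : M) : P x -> P (inv x).
Proof.
intros Px; rewrite <- (meadow_mul_inv M M_meadow (inv x)).
rewrite (meadow_inv_inv M M_meadow x).
now apply P_mul, P_mul.
Qed.

Lemma congr_inv (x y : M) : congr x y -> congr (inv x) (inv y).
Proof.
intros H; destruct (classic (P x)) as [Px|nPx].
- assert (Py : P y).
  { apply congr_zero; apply congr_trans with x; [now apply congr_sym|].
    now apply congr_zero. }
  apply congr_trans with zero; [|apply congr_sym];
    now apply congr_zero, maximal_inv.
- assert (nPy : ~ P y).
  { intros Py; apply nPx, congr_zero; apply congr_trans with y; [exact H|].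
    now apply congr_zero. }
  unfold congr.
  (* This is 1/x - 1/y = -(x - y)/(x y), corrected by multiples of 1 - x x^-1 and 1 - y y^-1, both
     of which lie in [P]. *)
  replace (sub (inv x) (inv y)) with
    (add (add (mul (inv x) (sub one (mul y (inv y))))
              (mul (opp (inv y)) (sub one (mul x (inv x)))))
         (mul (opp (mul (inv x) (inv y))) (sub x y))) by ring.
  repeat apply P_add; apply P_mul; try exact H; now apply maximal_mul_inv.
Qed.

(** * The quotient algebra, built on chosen representatives *)

Definition repr (x : M) : M := epsilon (inhabits x) (congr x).

Lemma congr_repr (x : M) : congr x (repr x).
Proof. unfold repr; apply epsilon_spec; exists x; apply congr_refl. Qed.

Lemma repr_eq (x y : M) : congr x y -> repr x = repr y.
Proof.
intros H; unfold repr.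
replace (congr y) with (congr x).
(* With the predicates identified, the two choices differ only in the proof that [M] is
   inhabited. *)
- f_equal; apply proof_irrelevance.
- apply functional_extensionality; intros z.
  apply propositional_extensionality; split; intros K.
  + apply congr_trans with x; [now apply congr_sym|exact K].
  + now apply congr_trans with y.
Qed.

(** Each class is encoded by its one chosen element, so that congruence in [M] becomes Leibniz
    equality. *)
Definition quot : Type := {x : M | repr x = x}.

Definition proj (x : M) : quot :=
  exist _ (repr x) (eq_sym (repr_eq _ _ (congr_repr x))).

Definition lift (q : quot) : M := proj1_sig q.

Lemma proj_eq (x y : M) : proj x = proj y <-> congr x y.
Proof.
split; intros H.
- apply congr_trans with (repr x); [apply congr_repr|].
  apply (f_equal lift) in H; simpl in H; rewrite H.
  apply congr_sym, congr_repr.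
- apply eq_sig_hprop; [intros; apply proof_irrelevance|].
  now apply repr_eq.
Qed.

Lemma proj_lift (q : quot) : proj (lift q) = q.
Proof.
apply eq_sig_hprop; [intros; apply proof_irrelevance|].
exact (proj2_sig q).
Qed.

Lemma congr_lift (x : M) : congr (lift (proj x)) x.
Proof. apply proj_eq, proj_lift. Qed.

Definition quot_algebra : sigma_algebra :=
  SigmaAlgebra quot (proj zero) (proj one)
    (fun q r => proj (add (lift q) (lift r)))
    (fun q r => proj (mul (lift q) (lift r)))
    (fun q => proj (opp (lift q)))
    (fun q => proj (inv (lift q))).

Lemma quot_add (x y : M) :
  @add quot_algebra (proj x) (proj y) = proj (add x y).
Proof. apply proj_eq, congr_add; apply congr_lift. Qed.

Lemma quot_mul (x y : M) :
  @mul quot_algebra (proj x) (proj y) = proj (mul x y).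
Proof. apply proj_eq, congr_mul; apply congr_lift. Qed.

Lemma quot_opp (x : M) : @opp quot_algebra (proj x) = proj (opp x).
Proof. apply proj_eq, congr_opp, congr_lift. Qed.

Lemma quot_inv (x : M) : @inv quot_algebra (proj x) = proj (inv x).
Proof. apply proj_eq, congr_inv, congr_lift. Qed.

Lemma quot_is_comm_ring : is_comm_ring quot_algebra.
Proof.
split; intros; repeat match goal with q : carrier quot_algebra |- _ =>
    rewrite <- (proj_lift q); generalize (lift q); clear q; intro end;
  change (@zero quot_algebra) with (proj zero);
  change (@one quot_algebra) with (proj one);
  repeat rewrite ?quot_opp, ?quot_add, ?quot_mul;
  apply (f_equal proj); ring.
Qed.

Lemma quot_is_zero_totalized_field : is_zero_totalized_field quot_algebra.
Proof.
split.
- exact quot_is_comm_ring.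
(* If 0 = 1 in the quotient, then 1 lies in [P], and hence so does d = d 1. *)
- intros E; apply P_notin.
  replace d with (mul d one) by ring.
  apply P_mul, congr_zero, congr_sym, proj_eq, E.
- intros q; rewrite <- (proj_lift q); generalize (lift q); clear q.
  intros x xn0; rewrite quot_inv, quot_mul.
  apply proj_eq, congr_sym, maximal_mul_inv.
  intros Px; apply xn0, proj_eq, congr_zero, Px.
- change (@zero quot_algebra) with (proj zero); rewrite quot_inv.
  apply proj_eq, congr_zero, maximal_inv, maximal_zero.
Qed.

Lemma quot_eval (v : nat -> M) (t : sigma_term) :
  eval quot_algebra (fun n => proj (v n)) t = proj (eval M v t).
Proof.
induction t as [n| | |t IHt s IHs|t IHt s IHs|t IHt|t IHt];
  cbn [eval]; try reflexivity.
- rewrite IHt, IHs; apply quot_add.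
- rewrite IHt, IHs; apply quot_mul.
- rewrite IHt; apply quot_opp.
- rewrite IHt; apply quot_inv.
Qed.

End MeadowQuotient.

Theorem theorem3p10 (e : sigma_equation) :
  (forall F : sigma_algebra, is_zero_totalized_field F -> holds F e) <->
  (forall M : sigma_algebra, is_meadow M -> holds M e).
Proof.
split; [|intros H F Ff; now apply H, zero_totalized_field_is_meadow].
intros H M Mm v; apply NNPP; intros neq.
set (d := add (eval M v (lhs e)) (opp (eval M v (rhs e)))).
assert (d_neq0 : d <> zero) by (intros d0; apply neq, sub_eq_zero; assumption).
destruct (exists_maximal_avoiding M d) as [P Pmax].
pose proof (H _ (quot_is_zero_totalized_field M Mm d P d_neq0 Pmax)
  (fun n => proj M Mm d P d_neq0 Pmax (v n))) as E.
(* Equality of the two projected values unfolds to membership of [d] in [P]. *)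
rewrite !quot_eval in E; apply proj_eq in E.
exact (proj2 (proj1 Pmax) E).
Qed.
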